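(* Let $Q$ be a probability distribution on the partition space $\mathcal{P}$ and let $X_1,\dots,X_n$ be drawn i.i.d. from $Q$ (for each $n$). Suppose that $\rho:\mathcal{P}\times\mathcal{P}\to\mathbb{R}$ is continuous in both arguments with respect to $\delta_2$. Then (1) $D(\mathcal{F}_n,\mathcal{F}_Q)\to0$ almost surely, and (2) $V_n\to V_Q$ almost surely, as $n\to\infty$.
   Context: Fix $1\le\ell\le m$. $\mathcal{X} = \{\mathbf{X}\in[0,1]^{\ell\times m} : \mathbf{X}^T\mathbf{1}_\ell = \mathbf{1}_m\}$; $\Pi$ is the group of $\ell\times\ell$ permutation matrices acting by left multiplication; the partition space $\mathcal{P}=\mathcal{X}/\Pi$ is the set of orbits $X=\{\mathbf{P}\mathbf{X}:\mathbf{P}\in\Pi\}$. The metric $\delta_2$ on $\mathcal{P}$ is $\delta_2(X,Y)=\min\{\|\mathbf{X}-\mathbf{Y}\|_2:\mathbf{X}\in X,\mathbf{Y}\in Y\}$ with $\|\cdot\|_2$ the Frobenius norm. For subsets $\mathcal{U},\mathcal{V}\subseteq\mathcal{P}$, $D(\mathcal{U},\mathcal{V})=\sup_{X\in\mathcal{U}}\inf_{Y\in\mathcal{V}}\delta_2(X,Y)$. The Fréchet function of the sample is $F_n(Z)=\frac1n\sum_{i=1}^n\rho(X_i,Z)$, $V_n=\inf_Z F_n(Z)$, $\mathcal{F}_n$ the set of minimizers of $F_n$; the expected Fréchet function is $F_Q(Z)=\int_{\mathcal{P}}\rho(X,Z)\,dQ(X)$, $V_Q=\inf_Z F_Q(Z)$,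 $\mathcal{F}_Q$ the set of minimizers of $F_Q$. *)

(* Defs.v *)
From HB Require Import structures.
From mathcomp Require Import all_boot all_order all_algebra all_fingroup.
From mathcomp Require Import all_classical all_reals all_analysis.
Set Implicit Arguments. Unset Strict Implicit. Unset Printing Implicit Defensive.
Import Order.TTheory GRing.Theory Num.Theory.
Local Open Scope classical_set_scope.
Local Open Scope ring_scope.

Definition frob (R : realType) (p q : nat) (A : 'M[R]_(p, q)) : R :=
  Num.sqrt (\sum_i \sum_j (A i j) ^+ 2).

Definition calX (R : realType) (l m : nat) : set 'M[R]_(l, m) :=
  [set X | (forall i j, 0 <= X i j <= 1) /\ (forall j, \sum_i X i j = 1)].

Definition orbit (R : realType) (l m : nat) (X : 'M[R]_(l, m)) : set 'M[R]_(l, m) :=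
  [set (perm_mx s *m X) | s in (setT : set 'S_l)].

Definition is_partition (R : realType) (l m : nat) (A : set 'M[R]_(l, m)) : Prop :=
  exists2 X, calX X & A = orbit X.

Definition Ppart (R : realType) (l m : nat) := {A : set 'M[R]_(l, m) | is_partition A}.

HB.instance Definition _ (R : realType) (l m : nat) := gen_eqMixin (Ppart R l m).
HB.instance Definition _ (R : realType) (l m : nat) := gen_choiceMixin (Ppart R l m).

(* a distinguished element (only needed to equip P with a pointed structure, l >= 1) *)
Definition e0mx (R : realType) (l m : nat) : 'M[R]_(l.+1, m) :=
  \matrix_(i, j) (i == ord0)%:R.

Lemma e0mx_calX (R : realType) (l m : nat) : calX (e0mx R l m).
Proof.
split=> [i j|j]; rewrite /e0mx.
  by rewrite mxE; case: (i == ord0); rewrite ?ler01 ?lexx.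
rewrite big_ord_recl mxE eqxx big1 ?addr0 // => i _.
by rewrite mxE.
Qed.

Definition Ppoint (R : realType) (l m : nat) : Ppart R l.+1 m :=
  exist _ (orbit (e0mx R l m)) (ex_intro2 _ _ _ (e0mx_calX R l m) erefl).

HB.instance Definition _ (R : realType) (l m : nat) :=
  isPointed.Build (Ppart R l.+1 m) (Ppoint R l m).

Definition delta2 (R : realType) (l m : nat) (A B : Ppart R l m) : R :=
  inf [set frob (x - y) | x in proj1_sig A & y in proj1_sig B].

Definition delta2_open (R : realType) (l m : nat) (U : set (Ppart R l m)) : Prop :=
  forall A, U A -> exists2 e : R, 0 < e & forall B, delta2 A B < e -> U B.

Definition PartSpace (R : realType) (l m : nat) :=
  g_sigma_algebraType (@delta2_open R l.+1 m).


(* Note: PartSpace R k m is the partition space for l = k.+1 rows (so l >= 1). *)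

Definition rho_continuous (R : realType) (k m : nat)
    (rho : PartSpace R k m -> PartSpace R k m -> R) : Prop :=
  forall (A B : PartSpace R k m) (e : R), 0 < e ->
    exists2 d : R, 0 < d & forall A' B' : PartSpace R k m,
      delta2 A A' < d -> delta2 B B' < d -> `|rho A' B' - rho A B| < e.

Definition iid (R : realType) (d d' : measure_display)
    (Omega : measurableType d) (T : measurableType d')
    (P : probability Omega R) (Q : probability T R) (X : nat -> Omega -> T) : Prop :=
  [/\ (forall i, measurable_fun setT (X i)),
      (forall i (B : set T), measurable B -> P (X i @^-1` B) = Q B) &
      (forall (s : seq nat) (B : nat -> set T), uniq s ->
         (forall i, measurable (B i)) ->
         P (\bigcap_(i in [set` s]) (X i @^-1` B i)) =
         (\prod_(i <- s) P (X i @^-1` B i))%E)].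

(* sample Frechet function F_n(Z) = 1/n sum_{i=1}^n rho(X_i, Z)  (X_1..X_n = X 0 .. X (n-1)) *)
Definition Fn (R : realType) (k m : nat) (T : Type)
    (rho : PartSpace R k m -> PartSpace R k m -> R) (X : nat -> T -> PartSpace R k m)
    (n : nat) (w : T) (Z : PartSpace R k m) : R :=
  n%:R^-1 * \sum_(i < n) rho (X i w) Z.

Definition Vn (R : realType) (k m : nat) (T : Type)
    (rho : PartSpace R k m -> PartSpace R k m -> R) (X : nat -> T -> PartSpace R k m)
    (n : nat) (w : T) : \bar R :=
  ereal_inf [set (Fn rho X n w Z)%:E | Z in [set: PartSpace R k m]].

Definition calFn (R : realType) (k m : nat) (T : Type)
    (rho : PartSpace R k m -> PartSpace R k m -> R) (X : nat -> T -> PartSpace R k m)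
    (n : nat) (w : T) : set (PartSpace R k m) :=
  [set Z | forall Z', Fn rho X n w Z <= Fn rho X n w Z'].

Definition FQ (R : realType) (k m : nat) (Q : probability (PartSpace R k m) R)
    (rho : PartSpace R k m -> PartSpace R k m -> R) (Z : PartSpace R k m) : \bar R :=
  (\int[Q]_A (rho A Z)%:E)%E.

Definition VQ (R : realType) (k m : nat) (Q : probability (PartSpace R k m) R)
    (rho : PartSpace R k m -> PartSpace R k m -> R) : \bar R :=
  ereal_inf [set FQ Q rho Z | Z in [set: PartSpace R k m]].

Definition calFQ (R : realType) (k m : nat) (Q : probability (PartSpace R k m) R)
    (rho : PartSpace R k m -> PartSpace R k m -> R) : set (PartSpace R k m) :=
  [set Z | forall Z', (FQ Q rho Z <= FQ Q rho Z')%E].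

Definition Dset (R : realType) (k m : nat) (U V : set (PartSpace R k m)) : \bar R :=
  ereal_sup [set ereal_inf [set (delta2 A B)%:E | B in V] | A in U].

(* Main.v *)
(* The partition space is the image of a compact set of matrices, hence compact,
   and compactness makes a continuous rho equicontinuous in each argument.  So
   for every e the space splits into finitely many measurable cells C_j with
   representatives x_j such that rho A Z is within e of rho x_j Z for all A in
   C_j and all Z at once.  Up to e, F_n and F_Q are then the sums over j of
   freq_n(C_j) rho(x_j, Z) and Q(C_j) rho(x_j, Z), and the strong law for the
   finitely many frequencies gives almost sure uniform convergence of F_n to
   F_Q.  Convergence of minima is immediate, and near-minimizers of F_Q are
   close to minimizers by compactness. *)
Require Import Defs.
From HB Require Import structures.
From mathcomp Require Import all_boot all_order all_algebra all_fingroup.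
From mathcomp Require Import all_classical all_reals all_analysis.
From mathcomp Require Import measurable_realfun lra ring zify.
Import Order.TTheory GRing.Theory Num.Theory.
Import numFieldNormedType.Exports.
Local Open Scope classical_set_scope.
Local Open Scope ring_scope.
Set Implicit Arguments. Unset Strict Implicit. Unset Printing Implicit Defensive.

(** * Compactness of the partition space *)

Lemma cvgr_sum (R : realType) (T I : Type) (F : set_system T) (r : seq I)
    (P : pred I) (f : I -> T -> R) (a : I -> R) :
  Filter F -> (forall i, P i -> f i x @[x --> F] --> a i) ->
  \sum_(i <- r | P i) f i x @[x --> F] --> \sum_(i <- r | P i) a i.
Proof. by move=> FF; apply: cvg_big; exact: add_continuous. Qed.

Lemma frobN (R : realType) (p q : nat) (A : 'M[R]_(p, q)) :
  frob (- A) = frob A.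
Proof.
congr Num.sqrt; apply: eq_bigr => i _; apply: eq_bigr => j _.
by rewrite mxE sqrrN.
Qed.

Lemma delta2_has_lbound (R : realType) (l m : nat) (A B : Ppart R l m) :
  has_lbound [set frob (x - y) | x in proj1_sig A & y in proj1_sig B].
Proof. by exists 0 => _ [x _ [y _ <-]]; exact: sqrtr_ge0. Qed.

Lemma orbit_refl (R : realType) (l m : nat) (x : 'M[R]_(l, m)) : Defs.orbit x x.
Proof. by exists 1%g => //; rewrite perm_mx1 mul1mx. Qed.

Lemma delta2_ge0 (R : realType) (l m : nat) (A B : Ppart R l m) :
  0 <= delta2 A B.
Proof.
apply: lb_le_inf => [|_ [x _ [y _ <-]]]; last exact: sqrtr_ge0.
have [x _ AE] := proj2_sig A; have [y _ BE] := proj2_sig B.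
exists (frob (x - y)), x; first by rewrite /= AE; exact: orbit_refl.
by exists y => //=; rewrite BE; exact: orbit_refl.
Qed.

Lemma delta2_sym (R : realType) (l m : nat) (A B : Ppart R l m) :
  delta2 A B = delta2 B A.
Proof.
congr (inf _); apply/seteqP; split => _ [x Ax [y By <-]];
  by exists y => //; exists x => //; rewrite -frobN opprB.
Qed.

Lemma delta2_le_frob (R : realType) (l m : nat) (A B : Ppart R l m) x y :
  proj1_sig A x -> proj1_sig B y -> delta2 A B <= frob (x - y).
Proof.
move=> Ax By; apply: ge_inf; first exact: delta2_has_lbound.
by exists x => //; exists y.
Qed.

Lemma delta2xx (R : realType) (l m : nat) (A : Ppart R l m) : delta2 A A = 0.
Proof.
apply/eqP; rewrite eq_le delta2_ge0 andbT.
have [x Ax] : exists x, proj1_sig A x.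
  by have [x _ ->] := proj2_sig A; exists x; exact: orbit_refl.
rewrite (le_trans (delta2_le_frob Ax Ax))// subrr /frob.
by rewrite big1 ?sqrtr0// => i _; rewrite big1// => j _; rewrite mxE expr0n.
Qed.

(** A closed subset of the unit cube, which is compact as a product of segments. Matrices are
    flattened to row vectors because [rV_compact] concerns these. *)
Lemma compact_calX (R : realType) (l m : nat) :
  compact [set v : 'rV[R]_(l * m) | calX (vec_mx v)].
Proof.
have box : compact [set v : 'rV[R]_(l * m) | forall i, `[0, 1]%classic (v ord0 i)].
  apply: (@rV_compact R _ (fun=> `[0, 1]%classic)) => i; exact: segment_compact.
apply: (subclosed_compact _ box); last first.
  move=> v [v01 _] k /=; case/mxvec_indexP: k => i j.
  by move: (v01 i j); rewrite mxE in_itv.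
(* Both constraints become preimages of closed sets under coordinates and column sums, which are
   continuous. *)
rewrite (_ : [set v | _] =
   (\bigcap_(ij in [set: 'I_l * 'I_m])
      ((fun v : 'rV[R]_(l * m) => v ord0 (mxvec_index ij.1 ij.2)) @^-1`
         `[0, 1]%classic)) `&`
   (\bigcap_(j in [set: 'I_m])
      ((fun v : 'rV[R]_(l * m) => \sum_i v ord0 (mxvec_index i j)) @^-1` [set 1]))); last first.
  apply/seteqP; split => v /=.
    move=> [v01 v1]; split => [[i j] _ /=|j _ /=].
      by move: (v01 i j); rewrite mxE in_itv.
    by rewrite -(v1 j); apply: eq_bigr => i _; rewrite mxE.
  move=> [v01 v1]; split => [i j|j].
    by move: (v01 (i, j) I); rewrite /= in_itv mxE.
  by rewrite -[RHS](v1 j I); apply: eq_bigr => i _; rewrite mxE.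
apply: closedI; apply: closed_bigI => x _; apply: preimage_closed.
- by move=> v _; exact: coord_continuous.
- exact: itv_closed.
- move=> v _; apply: cvgr_sum => [|i _]; first exact: nbhs_filter.
  exact: coord_continuous.
- exact: closed_eq.
Qed.

(** Links the topology of row vectors to the Frobenius norm: the latter is the root of a finite sum
    of squares of continuous coordinates. *)
Lemma near_frob (R : realType) (l m : nat) (v : 'rV[R]_(l * m)) (e : R) :
  0 < e -> \forall u \near v, frob (vec_mx v - vec_mx u) < e.
Proof.
move=> e0.
have : frob (vec_mx v - vec_mx u) @[u --> v] --> (0 : R).
  suff sq : \sum_i \sum_j ((vec_mx v - vec_mx u) i j) ^+ 2 @[u --> v] --> (0 : R).
    rewrite -[X in _ --> X]sqrtr0.
    exact: (cvg_comp _ _ sq (@sqrt_continuous R 0)).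
  rewrite [X in _ --> X](_ : 0 = \sum_(i < l) \sum_(j < m) 0); last first.
    by rewrite big1// => i _; rewrite big1.
  apply: cvgr_sum => [|i _]; first exact: nbhs_filter.
  apply: cvgr_sum => [|j _]; first exact: nbhs_filter.
  rewrite [X in _ --> X](_ : 0 = (v ord0 (mxvec_index i j) - v ord0 (mxvec_index i j)) ^+ 2); last first.
    by rewrite subrr expr0n.
  under eq_fun do rewrite !mxE.
  have diff : v ord0 (mxvec_index i j) - u ord0 (mxvec_index i j) @[u --> v] -->
      v ord0 (mxvec_index i j) - v ord0 (mxvec_index i j).
    by apply: cvgB; [exact: cvg_cst|exact: coord_continuous].
  exact: (cvg_comp _ _ diff (@exprn_continuous R 2 _)).
move=> /cvgr0Pnorm_lt /(_ _ e0); apply: filterS => u.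
by rewrite ger0_norm ?sqrtr_ge0.
Qed.

(* This is compactness; PartSpace carries no topology, so neighbourhoods are
   spelled out as delta2-balls. *)
Lemma partition_near_covering (R : realType) (k m : nat) (I : Type)
    (F : set_system I) (U : I -> PartSpace R k m -> Prop) :
  Filter F ->
  (forall A : PartSpace R k m, exists2 d : R, 0 < d &
     \forall i \near F, forall B : PartSpace R k m, delta2 A B < d -> U i B) ->
  \forall i \near F, forall B, U i B.
Proof.
move=> FF HU.
pose K := [set v : 'rV[R]_(k.+1 * m) | calX (vec_mx v)].
(* The quotient map, defined only on [K]; hence the covering property below quantifies over
   membership proofs. *)
pose q v (Kv : K v) : PartSpace R k m :=
  exist _ (Defs.orbit (vec_mx v)) (ex_intro2 (@calX R k.+1 m) _ (vec_mx v) Kv erefl).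
have /compact_near_coveringP/near_covering_withinP/(_ I F
    (fun i v => forall Kv : K v, U i (q v Kv)) FF) := @compact_calX R k.+1 m.
rewrite -/K => covering.
suff : \forall i \near F, K `<=` (fun v => forall Kv : K v, U i (q v Kv)).
  apply: filterS => i KU [B [x Xx BE]].
  have Kx : K (mxvec x) by rewrite /K /= mxvecK.
  rewrite (_ : exist _ _ _ = q _ Kx); first exact: KU.
  by apply: eq_exist; rewrite BE mxvecK.
apply: covering => v Kv; have [d d0 UF] := HU (q v Kv).
near=> u i => Ku Ku'.
have : forall B : PartSpace R k m, delta2 (q v Kv) B < d -> U i B by near: i.
apply.
(* Passing to orbits does not increase distances, so [q] is continuous for [delta2]. *)
have le_frob : delta2 (q v Kv) (q u Ku') <= frob (vec_mx v - vec_mx u).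
  by apply: delta2_le_frob; exact: orbit_refl.
apply: (le_lt_trans le_frob).
by near: u; exact: near_frob.
Unshelve. all: by end_near. Qed.

(** The finite-subcover form of compactness. A list holding the index that serves a ball about [A]
    settles that whole ball, and near covering merges these local lists into one. *)
Lemma partition_finite_cover (R : realType) (k m : nat)
    (V : PartSpace R k m -> PartSpace R k m -> Prop) :
  (forall A, exists x, exists2 d : R, 0 < d &
     forall B : PartSpace R k m, delta2 A B < d -> V x B) ->
  exists s : seq (PartSpace R k m), forall B, exists2 x, x \in s & V x B.
Proof.
move=> HV.
(* F is the filter of eventualities along finite subsets ordered by inclusion. *)
pose F : set_system (seq (PartSpace R k m)) :=
  [set S : set (seq _) | exists s0 : seq (PartSpace R k m),
     forall s : seq (PartSpace R k m), {subset s0 <= s} -> S s].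
have FF : Filter F.
  split; first by exists [::].
    move=> S S' [s0 sS] [s0' sS']; exists (s0 ++ s0') => s s0s.
    by split; [apply: sS|apply: sS'] => x xs; apply: s0s;
      rewrite mem_cat xs ?orbT.
  by move=> S S' SS' [s0 sS]; exists s0 => s /sS /SS'.
have [A|s0 sF] := @partition_near_covering R k m _ F
    (fun s B => exists2 x, x \in s & V x B) FF.
  have [x [d d0 dV]] := HV A; exists d => //.
  exists [:: x] => s xs B AB; exists x; last exact: dV.
  by apply: xs; rewrite mem_head.
by exists s0; exact: sF.
Qed.

(** * Equicontinuity, attained minima and near-minimizers *)

Lemma rho_continuous_flip (R : realType) (k m : nat)
    (rho : PartSpace R k m -> PartSpace R k m -> R) :
  rho_continuous rho -> rho_continuous (fun A B => rho B A).
Proof.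
by move=> rhoC A B e /(rhoC B A)[d d0 dr]; exists d => // A' B' AA BB; exact: dr.
Qed.

(** Joint continuity at [(A, Z)] gives a radius valid on a ball of second arguments; compactness in
    that argument makes the radius independent of [Z]. *)
Lemma rho_equicontinuous (R : realType) (k m : nat)
    (rho : PartSpace R k m -> PartSpace R k m -> R)
    (A : PartSpace R k m) (e : R) :
  rho_continuous rho -> 0 < e ->
  exists2 d : R, 0 < d &
    forall B, delta2 A B < d -> forall Z, `|rho B Z - rho A Z| < e.
Proof.
move=> rhoC e0.
have : \forall d \near (0:R)^'+, forall Z : PartSpace R k m,
    forall B : PartSpace R k m, delta2 A B < d -> `|rho B Z - rho A Z| < e.
  apply: partition_near_covering => Z.
  have [d d0 rd] := rhoC A Z _ (divr_gt0 e0 (ltr0n R 2)).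
  exists d => //; near=> c => Z' ZZ' B AB.
  have cd : c < d by near: c; exact: nbhs_right_lt.
  have r1 := rd B Z' (lt_trans AB cd) ZZ'.
  have r2 : `|rho A Z' - rho A Z| < e / 2 by apply: rd => //; rewrite delta2xx.
  (* Both values at [Z'] are compared with the value at the centre [(A, Z)], at a cost of [e / 2]
     each. *)
  rewrite (_ : _ - _ = (rho B Z' - rho A Z) - (rho A Z' - rho A Z)); last by ring.
  by rewrite (le_lt_trans (ler_normB _ _))// [e]splitr ltrD.
move=> near_d; near (0:R)^'+ => d.
have dr := near near_d d.
by exists d => // B AB Z; exact: dr.
Unshelve. all: by end_near. Qed.

Definition delta2_continuous (R : realType) (k m : nat)
    (f : PartSpace R k m -> R) : Prop :=
  forall A (e : R), 0 < e -> exists2 d : R, 0 < d &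
    forall B : PartSpace R k m, delta2 A B < d -> `|f B - f A| < e.

Lemma seq_has_min (T : eqType) (R : realType) (f : T -> R) (s : seq T) (x0 : T) :
  x0 \in s -> exists2 x, x \in s & forall y, y \in s -> f x <= f y.
Proof.
elim: s x0 => // a [|b s] IH x0 _.
  by exists a; rewrite ?mem_head// => y; rewrite mem_seq1 => /eqP ->.
have [x xs xmin] := IH b (mem_head _ _).
have [fax|fxa] := leP (f a) (f x).
  exists a; rewrite ?mem_head// => y; rewrite in_cons => /predU1P[->//|ys].
  by rewrite (le_trans fax)// xmin.
exists x; first by rewrite in_cons xs orbT.
by move=> y; rewrite in_cons => /predU1P[->|/xmin//]; exact: ltW.
Qed.

(** Without a minimizer, each point has a strictly better [x], which stays better on a ball.
    Finitely many such [x] beat every point, including the best among themselves. *)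
Lemma delta2_continuous_min (R : realType) (k m : nat)
    (f : PartSpace R k m -> R) :
  delta2_continuous f -> exists Z, forall Z', f Z <= f Z'.
Proof.
move=> fC; apply: contrapT => /forallNP nomin.
have [A|s scov] := @partition_finite_cover R k m (fun x B => f x < f B).
  have /existsNP[x /negP] := nomin A; rewrite -ltNge => fx.
  exists x; have [|d d0 df] := fC A (f A - f x); first by rewrite subr_gt0.
  by exists d => // B /df; rewrite ltr_distlC => /andP[? ?]; lra.
have [x0 x0s _] := scov point.
have [x _ xmin] := seq_has_min f x0s.
by have [y /xmin + fyx] := scov x; rewrite leNgt fyx.
Qed.

Lemma delta2_continuous_bounded (R : realType) (k m : nat)
    (f : PartSpace R k m -> R) :
  delta2_continuous f -> exists M, forall Z, `|f Z| <= M.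
Proof.
move=> fC.
have fNC : delta2_continuous (fun Z => - f Z).
  move=> A e /(fC A)[d d0 df]; exists d => // B /df.
  by rewrite -opprD normrN.
have [Z1 min1] := delta2_continuous_min fC.
have [Z2 min2] := delta2_continuous_min fNC.
exists (`|f Z1| + `|f Z2|) => Z; rewrite ler_norml.
have := min1 Z; have := min2 Z; have := ler_norm (f Z2).
have := ler_norm (- f Z1); rewrite normrN.
have := normr_ge0 (f Z1); have := normr_ge0 (f Z2).
by move=> *; apply/andP; split; lra.
Qed.

(** Near a minimizer, that minimizer is the required [B]. Near any other point, values exceed some
    [f Z0] by at least half a fixed gap, so a smaller [eta] excludes them. Compactness yields one
    [eta] for all. *)
Lemma near_minimizers (R : realType) (k m : nat) (f : PartSpace R k m -> R)
    (e : R) :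
  delta2_continuous f -> 0 < e ->
  exists2 eta : R, 0 < eta & forall Z, (forall Z', f Z <= f Z' + eta) ->
    exists2 B, (forall Z', f B <= f Z') & delta2 Z B < e.
Proof.
move=> fC e0.
have : \forall eta \near (0:R)^'+, forall Z : PartSpace R k m,
    (forall Z', f Z <= f Z' + eta) ->
    exists2 B : PartSpace R k m, (forall Z', f B <= f Z') & delta2 Z B < e.
  apply: partition_near_covering => A.
  have [Amin|/existsNP[Z0 /negP]] := pselect (forall Z', f A <= f Z').
    by exists e => //; near=> eta => B AB _; exists A => //; rewrite delta2_sym.
  rewrite -ltNge -subr_gt0 => gap.
  have [d d0 df] := fC A _ (divr_gt0 gap (ltr0n R 2)).
  exists d => //; near=> eta => B /df; rewrite ltr_distlC => /andP[? ?] /(_ Z0) ?.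
  have : eta < (f A - f Z0) / 2.
    by near: eta; apply: nbhs_right_lt; rewrite divr_gt0.
  by move=> ?; exfalso; lra.
move=> near_eta; near (0:R)^'+ => eta.
by exists eta => //; exact: (near near_eta eta).
Unshelve. all: by end_near. Qed.

(** * Consequences of uniform convergence *)

Lemma cvge_dist (R : realType) (u : nat -> \bar R) (l : R) :
  (forall e : R, 0 < e -> \forall n \near \oo,
     ((l - e)%:E <= u n <= (l + e)%:E)%E) ->
  u n @[n --> \oo] --> l%:E.
Proof.
move=> ul; apply/fine_cvgP; split.
  (* The bounds at [e = 1] already rule out infinite values. *)
  apply: filterS (ul 1 ltr01) => n.
  by case: (u n) => [r||] // /andP[]; rewrite ?leye_eq ?leeNy_eq.
apply/cvgrPdist_le => e e0; apply: filterS (ul e e0) => n /=.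
case: (u n) => [r||] /andP[]; rewrite ?leye_eq ?leeNy_eq//.
by rewrite /= !lee_fin ler_distl => ? ?; apply/andP; split; lra.
Qed.

Lemma norm_mean_le (R : realType) (n : nat) (u : 'I_n -> R) (c : R) :
  0 <= c -> (forall i, `|u i| <= c) -> `|n%:R^-1 * \sum_i u i| <= c.
Proof.
(* The empty mean is 0, which [c0] covers. *)
move=> c0 uc; case: n u uc => [|n] u uc; first by rewrite big_ord0 mulr0 normr0.
rewrite normrM ger0_norm ?invr_ge0// mulrC ler_pdivrMr//.
rewrite (le_trans (ler_norm_sum _ _ _))// (le_trans (ler_sum _ (fun i _ => uc i)))//.
by rewrite sumr_const card_ord mulr_natr.
Qed.

Lemma Fn_continuous (R : realType) (k m : nat) (T : Type)
    (rho : PartSpace R k m -> PartSpace R k m -> R)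
    (X : nat -> T -> PartSpace R k m) (n : nat) (w : T) :
  rho_continuous rho -> delta2_continuous (Fn rho X n w).
Proof.
move=> /rho_continuous_flip rhoC A e e0.
have [d d0 dr] := rho_equicontinuous A rhoC (divr_gt0 e0 (ltr0n R 2)).
exists d => // B AB; rewrite /Fn -mulrBr -sumrB.
apply: (@le_lt_trans _ _ (e / 2)); last by lra.
by apply: norm_mean_le => [|i]; [lra|exact/ltW/dr].
Qed.

Lemma Dset_cvg (R : realType) (k m : nat) (T : Type)
    (Q : probability (PartSpace R k m) R)
    (rho : PartSpace R k m -> PartSpace R k m -> R)
    (X : nat -> T -> PartSpace R k m) (w : T) (f : PartSpace R k m -> R) :
  rho_continuous rho -> delta2_continuous f -> (forall Z, FQ Q rho Z = (f Z)%:E) ->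
  (forall e : R, 0 < e -> \forall n \near \oo,
     forall Z, `|Fn rho X n w Z - f Z| <= e) ->
  Dset (calFn rho X n w) (calFQ Q rho) @[n --> \oo] --> 0%E.
Proof.
move=> rhoC fC fE ucv; apply: cvge_dist => e e0.
have [eta eta0 etaP] := near_minimizers fC e0.
(* Closeness [eta / 2], spent at [A] and at [Z'], turns a minimizer of [Fn] into an
   [eta]-near-minimizer of [f]. *)
apply: filterS (ucv _ (divr_gt0 eta0 (ltr0n R 2))) => n near_n.
rewrite sub0r add0r; apply/andP; split.
  (* A minimizer of [Fn] exists, so the supremum is not the value minus infinity of the empty
     set. *)
  have [A Amin] := delta2_continuous_min (Fn_continuous X n w rhoC).
  apply: (@le_trans _ _ 0%E); first by rewrite lee_fin; lra.
  apply: le_trans (ereal_sup_ubound _); last by exists A.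
  by apply: le_ereal_inf_tmp => _ [B _ <-]; rewrite lee_fin delta2_ge0.
apply: ge_ereal_sup => _ [A Amin <-].
have [Z'|B Bmin AB] := etaP A.
  have := near_n A; have := near_n Z'; have := Amin Z'.
  by rewrite !ler_distl => ? /andP[? ?] /andP[? ?]; lra.
apply: (@le_trans _ _ (delta2 A B)%:E); last by rewrite lee_fin ltW.
apply: ereal_inf_lbound; exists B => // Z'.
by rewrite !fE lee_fin.
Qed.

Lemma Vn_cvg (R : realType) (k m : nat) (T : Type)
    (Q : probability (PartSpace R k m) R)
    (rho : PartSpace R k m -> PartSpace R k m -> R)
    (X : nat -> T -> PartSpace R k m) (w : T) (f : PartSpace R k m -> R) :
  delta2_continuous f -> (forall Z, FQ Q rho Z = (f Z)%:E) ->
  (forall e : R, 0 < e -> \forall n \near \oo,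
     forall Z, `|Fn rho X n w Z - f Z| <= e) ->
  Vn rho X n w @[n --> \oo] --> VQ Q rho.
Proof.
move=> fC fE ucv; have [Z0 Z0min] := delta2_continuous_min fC.
have -> : VQ Q rho = (f Z0)%:E.
  apply/eqP; rewrite eq_le; apply/andP; split.
    by apply: ereal_inf_lbound; exists Z0.
  by apply: le_ereal_inf_tmp => _ [Z _ <-]; rewrite fE lee_fin.
apply: cvge_dist => e e0; apply: filterS (ucv _ e0) => n near_n.
apply/andP; split.
  apply: le_ereal_inf_tmp => _ [Z _ <-]; rewrite lee_fin.
  by have := near_n Z; have := Z0min Z; rewrite ler_distl => ? /andP[? ?]; lra.
apply: (@le_trans _ _ (Fn rho X n w Z0)%:E); first by apply: ereal_inf_lbound; exists Z0.
by have := near_n Z0; rewrite lee_fin ler_distl => /andP[].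
Qed.

(** * A strong law for events *)

Lemma Rintegral_indic d (T : measurableType d) (R : realType)
    (P : probability T R) (A : set T) :
  measurable A -> \int[P]_w (\1_A w) = fine (P A).
Proof. by move=> mA; rewrite /Rintegral integral_indic// setIT. Qed.

Lemma integrable_indic_mul d (T : measurableType d) (R : realType)
    (P : probability T R) (A B : set T) (p : R) :
  measurable A -> measurable B ->
  P.-integrable setT (EFin \o (fun w => (\1_A w - p) * (\1_B w - p))).
Proof.
move=> mA mB; apply: measurable_bounded_integrable => //.
- by rewrite [X in (X < _)%E]probability_setT ltry.
- by apply: measurable_funM; apply: measurable_funB => //.
exists ((1 + `|p|) * (1 + `|p|)); split; first exact: num_real.
move=> x /ltW Mx w _ /=; apply: (le_trans _ Mx).
have bnd (C : set T) : `|\1_C w - p| <= 1 + `|p|.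
  rewrite (le_trans (ler_normB _ _))// lerD2r indicE.
  by case: (w \in C); rewrite ?normr1 ?normr0.
by rewrite normrM ler_pM.
Qed.

(** The covariance of two events of common probability [p], by expanding the product. *)
Lemma Rintegral_indic_mul d (T : measurableType d) (R : realType)
    (P : probability T R) (A B : set T) (p : R) :
  measurable A -> measurable B -> P A = p%:E -> P B = p%:E ->
  \int[P]_w ((\1_A w - p) * (\1_B w - p)) = fine (P (A `&` B)) - p * p.
Proof.
move=> mA mB PA PB.
have iI C : measurable C -> P.-integrable setT (EFin \o \1_C).
  by move=> mC; exact: integrable_indic.
have iZ C : measurable C -> P.-integrable setT (EFin \o (fun w => p * \1_C w)).
  move=> mC; rewrite (_ : _ \o _ = fun w => (p%:E * (\1_C w)%:E)%E)//.
  by apply: integrableZl => //; exact: iI.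
have iC : P.-integrable setT (EFin \o (fun=> p * p)).
  exact: finite_measure_integrable_cst.
have -> : (fun w => (\1_A w - p) * (\1_B w - p)) =
    (fun w => ((\1_(A `&` B) w - p * \1_A w) - p * \1_B w) + p * p :> R).
  by apply/funext => w; rewrite indicI /=; ring.
have iD (f g : T -> R) : P.-integrable setT (EFin \o f) -> P.-integrable setT (EFin \o g) ->
    P.-integrable setT (EFin \o (fun w => f w - g w)).
  by move=> fi gi; exact: (integrableB measurableT fi gi).
have mAB := measurableI _ _ mA mB.
have i1 := iD _ _ (iI _ mAB) (iZ _ mA); have i2 := iD _ _ i1 (iZ _ mB).
rewrite (RintegralD measurableT i2 iC) (RintegralB measurableT i1 (iZ _ mB)).
rewrite (RintegralB measurableT (iI _ mAB) (iZ _ mA)).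
rewrite (RintegralZl _ measurableT (iI _ mA)) (RintegralZl _ measurableT (iI _ mB)).
rewrite !Rintegral_indic// PA PB /= Rintegral_cst//.
rewrite [X in _ + _ * X](_ : _ = 1); first by ring.
exact: (congr1 fine (probability_setT P)).
Qed.

(** The square expands into covariances: those off the diagonal vanish, and each of the [n] diagonal
    ones is [p - p * p <= 1]. *)
Lemma second_moment_le d (T : measurableType d) (R : realType)
    (P : probability T R) (E : nat -> set T) (p : R) (n : nat) :
  (forall i, measurable (E i)) -> (forall i, P (E i) = p%:E) ->
  (forall i j, i != j -> P (E i `&` E j) = (p * p)%:E) ->
  (\int[P]_w ((\sum_(i < n) (\1_(E i) w - p)) ^+ 2)%:E <= n%:R%:E)%E.
Proof.
move=> mE PE PEE.
pose a (i : 'I_n) w : R := \1_(E i) w - p.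
have ia i j : P.-integrable setT (fun w => (a i w * a j w)%:E).
  exact: integrable_indic_mul.
have aE i j : (\int[P]_w (a i w * a j w)%:E = (fine (P (E i `&` E j)) - p * p)%:E)%E.
  rewrite -(@Rintegral_indic_mul _ _ _ P)// /Rintegral fineK//.
  exact: (integrable_fin_num measurableT (ia i j)).
under eq_integral => w _.
  rewrite expr2 big_distrlr /= -sumEFin.
  under eq_bigr do rewrite -sumEFin.
  over.
rewrite /= integral_sum//; last first.
  by move=> i; apply: integrable_sum => // j _; exact: ia.
rewrite -[n in leRHS]card_ord -sum1_card natr_sum -sumEFin; apply: lee_sum => i _.
rewrite integral_sum//; last by move=> j; exact: ia.
rewrite (bigD1 i)//= big1 => [|j ij].
  by rewrite aE adde0 setIid PE lee_fin /=; nra.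
by rewrite aE PEE ?subrr// eq_sym.
Qed.

Lemma nneseries_sqr_le (R : realType) (u : nat -> \bar R) :
  (forall n, 0 <= u n)%E -> (forall n, u n <= ((n.+1%:R ^+ 2)^-1)%:E)%E ->
  (\sum_(0 <= n <oo) u n <= 2%:E)%E.
Proof.
move=> u0 uM; apply: lime_le.
  by apply: is_cvg_ereal_nneg_natsum => n _; exact: u0.
apply: nearW => n.
(* 1 / (n + 1)^2 <= 2 / (n + 1) - 2 / (n + 2), which telescopes. *)
suff : (\sum_(0 <= i < n) u i <= (2 - 2 / n.+1%:R)%:E)%E.
  move=> /le_trans; apply; rewrite lee_fin gerBl.
  by rewrite divr_ge0.
elim: n => [|n IH]; first by rewrite big_geq// divr1 subrr.
rewrite big_nat_recr//= (le_trans (leeD IH (uM n)))// lee_fin.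
have n0 : 0 <= n%:R :> R by [].
rewrite -[n.+2%:R]natr1 -[n.+1%:R]natr1.
move: (n%:R : R) n0 => x x0.
have y0 : 0 < x + 1 by lra.
have z0 : 0 < x + 1 + 1 by lra.
rewrite -subr_ge0 (_ : _ - _ = x / ((x + 1) ^+ 2 * (x + 1 + 1))).
  by rewrite divr_ge0// mulr_ge0 ?sqr_ge0// ltW.
by field; rewrite !gt_eqF.
Qed.

Lemma square_bracket (k : nat) : (0 < k)%N ->
  exists n, (n.+1 ^ 2 <= k < n.+2 ^ 2)%N.
Proof.
elim: k => // -[_ _|k /(_ isT)[n /andP[n1 n2]] _]; first by exists 0%N.
have [kn|nk] := ltnP k.+2 (n.+2 ^ 2); first by exists n; apply/andP; split; lia.
by exists n.+1; apply/andP; split => //; lia.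
Qed.

(** Consecutive squares around [k] differ by an amount of order the square root of [k], so the
    bounded terms in between change the mean negligibly. *)
Lemma cvg_mean_of_squares (R : realType) (b : nat -> R) (p : R) :
  (forall i, `|b i - p| <= 1) ->
  (\sum_(i < n.+1 ^ 2) (b i - p)) / (n.+1 ^ 2)%:R @[n --> \oo] --> (0 : R) ->
  n%:R^-1 * \sum_(i < n) b i @[n --> \oo] --> p.
Proof.
move=> bp cvg_sq; pose D n := \sum_(i < n) (b i - p).
have D_add n j : `|D (n + j)%N| <= `|D n| + j%:R.
  elim: j => [|j IH]; first by rewrite addn0 addr0.
  rewrite addnS /D big_ord_recr /= (le_trans (ler_normD _ _))//.
  by rewrite -natr1 addrA lerD.
apply/cvgrPdist_le => e e0.
have /cvgrPdist_lt/(_ _ (divr_gt0 e0 (ltr0n R 2)))[N _ DN] := cvg_sq.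
(* The gap past the square is at most [3 * n.+1]; once [6 < e * n.+1] this is below
   [e / 2 * n.+1 ^ 2], the other half of the error. *)
have [M Me] : exists M : nat, 6 / e < M%:R.
  by exists (Num.truncn (6 / e)).+1; exact: truncnS_gt.
exists ((maxn N M).+2 ^ 2)%N => // k /= kNM.
have [|n /andP[n1 n2]] := @square_bracket k; first by lia.
have [Nn Mn] : (N <= n)%N /\ (M <= n)%N by nia.
have k0 : 0 < k%:R :> R by rewrite ltr0n; nia.
have -> : p - k%:R^-1 * \sum_(i < k) b i = - (D k / k%:R).
  rewrite /D sumrB sumr_const card_ord -mulr_natr; field.
  by rewrite gt_eqF.
rewrite normrN normrM [`|_^-1|]ger0_norm ?invr_ge0// ler_pdivrMr//.
have := DN n Nn; rewrite sub0r normrN normrM [`|_^-1|]ger0_norm ?invr_ge0//.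
rewrite ltr_pdivrMr ?ltr0n// -/(D _) => Dsq.
have := D_add (n.+1 ^ 2)%N (k - n.+1 ^ 2)%N; rewrite subnKC// => Dk.
have : (k - n.+1 ^ 2)%:R <= 3 * n.+1%:R :> R by rewrite -natrM ler_nat; nia.
have sqk : (n.+1 ^ 2)%:R <= k%:R :> R by rewrite ler_nat.
have : 6 < e * n.+1%:R.
  rewrite mulrC -ltr_pdivrMr// (lt_le_trans Me)// ler_nat; lia.
move: sqk Dsq Dk; rewrite natrX; move: (D k) (D _) (n.+1%:R : R) (k%:R : R).
move=> Dk Dn x y xy Dsq Dky ex3; nra.
Qed.

(* The mean D n over the first (n+1)^2 trials has variance at most 1/(n+1)^2, which
   is summable; hence the squared deviations have an almost surely finite sum. *)
Lemma event_slln d (T : measurableType d) (R : realType)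
    (P : probability T R) (E : nat -> set T) (p : R) :
  (forall i, measurable (E i)) -> (forall i, P (E i) = p%:E) ->
  (forall i j, i != j -> P (E i `&` E j) = (p * p)%:E) ->
  {ae P, forall w, n%:R^-1 * \sum_(i < n) \1_(E i) w @[n --> \oo] --> p}.
Proof.
move=> mE PE PEE.
have p0 : 0 <= p by rewrite -lee_fin -(PE 0%N).
have p1 : p <= 1 by rewrite -lee_fin -(PE 0%N); exact: probability_le1.
pose D n w : R := (\sum_(i < n.+1 ^ 2) (\1_(E i) w - p)) / (n.+1 ^ 2)%:R.
have mD n : measurable_fun setT (fun w => (D n w ^+ 2)%:E).
  apply/measurable_EFinP; apply: measurable_funX; apply: measurable_funM => //.
  by apply: measurable_sum => i; exact: measurable_funB.
have D2 n : (\int[P]_w (D n w ^+ 2)%:E <= ((n.+1%:R ^+ 2)^-1)%:E)%E.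
  have n0 : 0 < (n.+1 ^ 2)%:R :> R by rewrite ltr0n.
  under eq_integral do rewrite exprMn mulrC EFinM.
  rewrite ge0_integralZl//; last 2 first.
  - apply/measurable_EFinP; apply: measurable_funX.
    by apply: measurable_sum => i; exact: measurable_funB.
  - by move=> w _; rewrite lee_fin sqr_ge0.
  (* The second moment of the sum is at most its number of terms; normalization divides by the
     square of that number. *)
  apply: (@le_trans _ _ ((((n.+1 ^ 2)%:R : R)^-1 ^+ 2)%:E * (n.+1 ^ 2)%:R%:E)%E).
    by apply: lee_wpmul2l; [rewrite lee_fin sqr_ge0|exact: second_moment_le].
  have n1 : n.+1%:R != 0 :> R by [].
  rewrite -EFinM lee_fin natrX le_eqVlt; apply/orP; left; apply/eqP.
  by move: (n.+1%:R : R) n1 => x x0; field.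
pose S w : \bar R := (\sum_(0 <= n <oo) (D n w ^+ 2)%:E)%E.
have S0 w : (0 <= S w)%E by apply: nneseries_ge0 => n _ _; rewrite lee_fin sqr_ge0.
have mS : measurable_fun setT S.
  by apply: ge0_emeasurable_sum => // n w _ _; rewrite lee_fin sqr_ge0.
have iS : P.-integrable setT S.
  apply/integrableP; split => //.
  under eq_integral do rewrite gee0_abs//.
  rewrite integral_nneseries//; last by move=> n w _; rewrite lee_fin sqr_ge0.
  apply: (@le_lt_trans _ _ 2%:E); last exact: ltry.
  apply: nneseries_sqr_le => // n.
  by apply: integral_ge0 => w _; rewrite lee_fin sqr_ge0.
(* Where [S] is finite, its terms tend to 0, giving convergence along the squares. *)
apply: filterS (integrable_ae measurableT iS) => w /(_ I) Sfin.
apply: (@cvg_mean_of_squares R (fun i => \1_(E i) w)).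
  by move=> i; rewrite indicE ler_norml; case: (w \in E i) => /=; apply/andP; split; lra.
have sq0 : D n w ^+ 2 @[n --> \oo] --> (0 : R).
  apply: cvg_series_cvg_0; apply: nnseries_is_cvg => [n|]; first exact: sqr_ge0.
  by rewrite -ge0_fin_numE//; exact: S0.
apply/cvgrPdist_lt => e e0.
move/cvgrPdist_lt : sq0 => /(_ _ (exprn_gt0 2 e0)); apply: filterS => n.
rewrite !sub0r !normrN -/(D n w) normrX.
by rewrite ltr_pXn2r// ?nnegrE// ltW.
Qed.

(** * Almost sure uniform convergence *)

Lemma measurable_delta2_open (R : realType) (k m : nat)
    (U : set (PartSpace R k m)) : delta2_open U -> measurable U.
Proof. by move=> Uo; exact: sub_sigma_algebra. Qed.

Lemma delta2_continuous_measurable (R : realType) (k m : nat)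
    (f : PartSpace R k m -> R) :
  delta2_continuous f -> measurable_fun setT f.
Proof.
move=> fC; apply: (measurability _ (RGenOInfty.measurableE R)) => _ [_ [x ->] <-].
rewrite setTI; apply: measurable_delta2_open => A /=.
rewrite in_itv/= andbT -subr_gt0 => /(fC A)[d d0 df].
exists d => // B /df; rewrite ltr_distl => /andP[? ?].
by rewrite /= in_itv/= andbT; lra.
Qed.

Lemma rho_continuousl (R : realType) (k m : nat)
    (rho : PartSpace R k m -> PartSpace R k m -> R) (Z : PartSpace R k m) :
  rho_continuous rho -> delta2_continuous (rho ^~ Z).
Proof.
move=> rhoC A e /(rhoC A Z)[d d0 dr]; exists d => // B AB.
by apply: dr => //; rewrite delta2xx.
Qed.

Lemma partition_cells (R : realType) (k m : nat)
    (rho : PartSpace R k m -> PartSpace R k m -> R) (e : R) :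
  rho_continuous rho -> 0 < e ->
  exists N (C : nat -> set (PartSpace R k m)) (x : nat -> PartSpace R k m),
    (forall j, measurable (C j)) /\
    (forall A Z, `|rho A Z - \sum_(j < N) \1_(C j) A * rho (x j) Z| <= e).
Proof.
move=> rhoC e0.
pose V x : set (PartSpace R k m) := [set A | forall Z, `|rho A Z - rho x Z| <= e].
(* [V x] is closed: a violation at some [Z] persists on a ball. *)
have mV x : measurable (V x).
  rewrite -[V x]setCK; apply: measurableC; apply: measurable_delta2_open.
  move=> A /existsNP[Z /negP]; rewrite -ltNge -subr_gt0.
  move=> /(rho_continuousl Z rhoC A)[d d0 dr]; exists d => // B /dr.
  move=> /= AB BV; have {BV} := BV Z; rewrite leNgt => /negP; apply.
  have := ler_distD (rho B Z) (rho A Z) (rho x Z).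
  by rewrite (distrC (rho A Z) (rho B Z)); lra.
have [A|s scov] := @partition_finite_cover R k m V.
  have [d d0 dr] := rho_equicontinuous A rhoC e0.
  by exists A, d => // B AB Z; exact/ltW/dr.
(* Disjointifying the cover leaves exactly one nonzero indicator at each [A]. Indices beyond
   [size s] give the default [point], outside the range of the sum. *)
exists (size s), (seqDU (fun j => V (nth point s j))), (nth point s).
split=> [j|A Z]; first exact: seqDU_measurable.
have [i iA i_s] : exists2 i : nat, seqDU (fun j => V (nth point s j)) i A & (i < size s)%N.
  have [y ys Vy] := scov A.
  have : (\bigcup_(i < size s) V (nth point s i)) A.
    by exists (index y s); rewrite /= ?index_mem// nth_index.
  rewrite bigcup_mkord (bigsetU_seqDU (fun j => V (nth point s j))).
  by rewrite -bigcup_mkord => -[i]; exists i.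
have AV : V (nth point s i) A := subset_seqDU iA.
rewrite (bigD1 (Ordinal i_s))//= big1 ?addr0 => [|j ji].
  by rewrite indicE mem_set// mul1r; exact: AV.
rewrite indicE memNset ?mul0r// => jA.
move/eqP : ji; apply; apply: val_inj => /=.
by apply: (trivIset_seqDU (fun j => V (nth point s j))) => //; exists A.
Qed.

Lemma norm_Rintegral_le d (T : measurableType d) (R : realType)
    (P : probability T R) (f : T -> R) (c : R) :
  P.-integrable setT (EFin \o f) -> (forall x, `|f x| <= c) ->
  `|\int[P]_x f x| <= c.
Proof.
move=> fi fc; rewrite (le_trans (le_normr_Rintegral _ fi))//.
have -> : c = \int[P]_x c.
  rewrite Rintegral_cst// [X in _ * X](_ : _ = 1) ?mulr1//.
  exact: (congr1 fine (probability_setT P)).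
apply: le_Rintegral => //.
- exact: (integrable_norm fi).
- exact: finite_measure_integrable_cst.
Qed.

Lemma delta2_continuous_integrable (R : realType) (k m : nat)
    (Q : probability (PartSpace R k m) R) (f : PartSpace R k m -> R) :
  delta2_continuous f -> Q.-integrable setT (EFin \o f).
Proof.
move=> fC; have [M fM] := delta2_continuous_bounded fC.
apply: measurable_bounded_integrable => //.
- by rewrite [X in (X < _)%E]probability_setT ltry.
- exact: delta2_continuous_measurable.
- by exists M; split; [exact: num_real|move=> x /ltW Mx A _; exact: le_trans Mx].
Qed.

Lemma FQ_Rintegral (R : realType) (k m : nat)
    (Q : probability (PartSpace R k m) R)
    (rho : PartSpace R k m -> PartSpace R k m -> R) (Z : PartSpace R k m) :
  rho_continuous rho -> FQ Q rho Z = (\int[Q]_A rho A Z)%:E.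
Proof.
move=> /(rho_continuousl Z) /(delta2_continuous_integrable Q) ri.
by rewrite /Rintegral fineK//; exact: (integrable_fin_num measurableT ri).
Qed.

(** Equicontinuity after flipping the arguments bounds the integrand's variation uniformly in the
    integration variable. *)
Lemma FQ_continuous (R : realType) (k m : nat)
    (Q : probability (PartSpace R k m) R)
    (rho : PartSpace R k m -> PartSpace R k m -> R) :
  rho_continuous rho -> delta2_continuous (fun Z => \int[Q]_A rho A Z).
Proof.
move=> rhoC A e e0.
have [d d0 dr] :=
  rho_equicontinuous A (rho_continuous_flip rhoC) (divr_gt0 e0 (ltr0n R 2)).
exists d => // B AB.
have ri Z : Q.-integrable setT (EFin \o rho ^~ Z).
  exact/delta2_continuous_integrable/rho_continuousl.
rewrite -RintegralB//; apply: (@le_lt_trans _ _ (e / 2)); last by lra.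
apply: norm_Rintegral_le => [|Z]; last exact/ltW/dr.
exact: (integrableB measurableT (ri B) (ri A)).
Qed.

Lemma iid_frequencies (R : realType) d d' (Omega : measurableType d)
    (T : measurableType d') (P : probability Omega R) (Q : probability T R)
    (X : nat -> Omega -> T) (C : set T) :
  iid P Q X -> measurable C ->
  {ae P, forall w, n%:R^-1 * \sum_(i < n) \1_C (X i w) @[n --> \oo] --> fine (Q C)}.
Proof.
move=> [mX XQ indep] mC.
have QC : Q C = (fine (Q C))%:E by rewrite fineK// fin_num_measure.
have mXC i : measurable (X i @^-1` C) by rewrite -[_ @^-1` _]setTI; exact: mX.
have PX i : P (X i @^-1` C) = (fine (Q C))%:E by rewrite XQ.
apply: filterS (@event_slln _ _ _ P (fun i => X i @^-1` C) _ mXC PX _) => [w|i j ij].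
  by [].
(* The product rule for two trials is independence for a two-element list. *)
have := indep [:: i; j] (fun=> C); rewrite /= inE andbT ij => /(_ isT)/(_ (fun=> mC)).
rewrite !big_cons big_nil mule1 !PX -EFinM => <-; congr (P _).
apply/seteqP; split => [w [iC jC] l /=|w ijC].
  by rewrite !inE => /orP[]/eqP ->.
by split; apply: ijC; rewrite /= !inE eqxx ?orbT.
Qed.

Lemma integral_cells d (T : measurableType d) (R : realType)
    (P : probability T R) (N : nat) (C : nat -> set T) (a : nat -> R) :
  (forall j, measurable (C j)) ->
  P.-integrable setT (EFin \o (fun x => \sum_(j < N) \1_(C j) x * a j)) /\
  \int[P]_x (\sum_(j < N) \1_(C j) x * a j) = \sum_(j < N) fine (P (C j)) * a j.
Proof.
move=> mC.
have iC j : P.-integrable setT (EFin \o (fun x => \1_(C j) x * a j)).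
  rewrite (_ : _ \o _ = fun x => ((\1_(C j) x)%:E * (a j)%:E)%E)//.
  by apply: integrableZr => //; exact: integrable_indic.
elim: N => [|N [IHi IH]].
  under eq_fun do rewrite big_ord0.
  rewrite big_ord0 Rintegral_cst// mul0r; split => //.
  exact: finite_measure_integrable_cst.
under eq_fun do rewrite big_ord_recr /=.
split; first exact: (integrableD measurableT IHi (iC N)).
rewrite (RintegralD measurableT IHi (iC N)) IH big_ord_recr /=.
rewrite (RintegralZr _ measurableT (integrable_indic P (mC N))).
by rewrite Rintegral_indic.
Qed.

(** Three errors of [e / 3]: from [Fn] to its cell sum, from frequencies to probabilities, and from
    that cell sum to the integral. *)
Lemma Fn_uniform_cvg (R : realType) (k m : nat) d (Omega : measurableType d)
    (P : probability Omega R) (Q : probability (PartSpace R k m) R)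
    (X : nat -> Omega -> PartSpace R k m)
    (rho : PartSpace R k m -> PartSpace R k m -> R) (e : R) :
  iid P Q X -> rho_continuous rho -> 0 < e ->
  {ae P, forall w, \forall n \near \oo,
     forall Z, `|Fn rho X n w Z - \int[Q]_A rho A Z| <= e}.
Proof.
move=> XQ rhoC e0.
have [|N [C [x [mC approx]]]] := @partition_cells R k m rho (e / 3) rhoC.
  by rewrite divr_gt0.
(* The bounds [M j] make the frequency error independent of [Z]. *)
have /choice[M xM] : forall j, exists M, forall Z, `|rho (x j) Z| <= M.
  move=> j; apply: delta2_continuous_bounded.
  exact: (rho_continuousl (x j) (rho_continuous_flip rhoC)).
apply: filterS (ae_foralln (fun j => iid_frequencies XQ (mC j))) => w freq.
pose fr j n : R := n%:R^-1 * \sum_(i < n) \1_(C j) (X i w).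
have err0 : \sum_(j < N) `|fr j n - fine (Q (C j))| * M j @[n --> \oo] --> (0 : R).
  rewrite [X in _ --> X](_ : 0 = \sum_(j < N) `|fine (Q (C j)) - fine (Q (C j))| * M j); last first.
    by rewrite big1// => j _; rewrite subrr normr0 mul0r.
  apply: cvgr_sum => j _; apply: cvgMl; apply: cvg_norm; apply: cvgB; last exact: cvg_cst.
  exact: freq.
have /cvgrPdist_le/(_ (e / 3)) := err0.
rewrite divr_gt0// => /(_ isT); apply: filterS => n errn Z.
have [ci cE] := integral_cells Q N (fun j => rho (x j) Z) mC.
have ri : Q.-integrable setT (EFin \o rho ^~ Z).
  exact/delta2_continuous_integrable/rho_continuousl.
have e3 : 0 <= e / 3 by rewrite divr_ge0// ltW.
have := norm_Rintegral_le (integrableB measurableT ri ci) (approx ^~ Z).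
rewrite RintegralB// cE => intE.
have := norm_mean_le e3 (fun i : 'I_n => approx (X i w) Z).
(* Summing over the sample first turns the averaged cell approximation into a combination of the
   frequencies [fr j n]. *)
rewrite sumrB mulrBr -/(Fn rho X n w Z) exchange_big mulr_sumr /=.
under eq_bigr do rewrite -mulr_suml mulrA -/(fr _ n).
move=> meanE.
have errZ : `|\sum_(j < N) fr j n * rho (x j) Z - \sum_(j < N) fine (Q (C j)) * rho (x j) Z| <= e / 3.
  move: errn; rewrite sub0r normrN => /(le_trans (ler_norm _)); apply: le_trans.
  rewrite -sumrB (le_trans (ler_norm_sum _ _ _))//; apply: ler_sum => j _.
  by rewrite -mulrBl normrM ler_wpM2l.
move: meanE errZ intE; rewrite !ler_norml => /andP[? ?] /andP[? ?] /andP[? ?].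
by apply/andP; split; lra.
Qed.

(* l = k.+1 rows (so 1 <= l), m columns, l <= m *)
Theorem theorem3 (R : realType) (k m : nat) (hlm : (k.+1 <= m)%N)
    (d : measure_display) (Omega : measurableType d) (P : probability Omega R)
    (Q : probability (PartSpace R k m) R)
    (X : nat -> Omega -> PartSpace R k m)
    (rho : PartSpace R k m -> PartSpace R k m -> R) :
  iid P Q X -> rho_continuous rho ->
  {ae P, forall w, Dset (calFn rho X n w) (calFQ Q rho) @[n --> \oo] --> 0%E} /\
  {ae P, forall w, Vn rho X n w @[n --> \oo] --> VQ Q rho}.
Proof.
move=> XQ rhoC.
have fC := FQ_continuous Q rhoC.
have fE Z := FQ_Rintegral Q Z rhoC.
have ucv : {ae P, forall w, forall e : R, 0 < e -> \forall n \near \oo,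
    forall Z, `|Fn rho X n w Z - \int[Q]_A rho A Z| <= e}.
  (* The exceptional null set depends on [e]; restricting to [e = 1 / (r + 1)] leaves countably
     many, so one null set serves every [e]. *)
  have inv0 r : 0 < r.+1%:R^-1 :> R by rewrite invr_gt0.
  apply: filterS (ae_foralln (fun r => Fn_uniform_cvg XQ rhoC (inv0 r))).
  move=> w unif e e0; have [r re] : exists r : nat, r.+1%:R^-1 <= e.
    exists (Num.truncn e^-1); rewrite invf_ple ?posrE//.
    exact/ltW/truncnS_gt.
  by apply: filterS (unif r) => n near_n Z; exact: le_trans (near_n Z) re.
split; apply: filterS ucv => w ucv.
- exact: Dset_cvg rhoC fC fE ucv.
- exact: Vn_cvg fC fE ucv.
Qed.
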